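(* Let $p,q\ge 0$ be integers, and let $\alpha_1,\dots,\alpha_p$, $\beta_1,\dots,\beta_q$, $c$, $(\lambda,\tau)$, $\mu_n(c)$, $\vec{\mu}(c)$ and the vector polynomials $\vec{P}_n(c)$ be as defined in the context. Let $$G_\mu(c,w)=\sum_{n=0}^{\infty}\mu_n(c)\frac{w^n}{n!},\qquad \vec{G}_P(c,w)=\sum_{n=0}^{\infty}\vec{P}_n(c)\frac{w^n}{n!}$$ be the exponential generating functions, understood as formal power series in $w$. Then $$G_\mu(c,w)=\mu_0\left(ce^{w}\right)$$ and $$\vec{G}_P(c,w)\cdot\vec{\mu}(c)=\mu_0\left(ce^{(\lambda+\tau c)w}\right),$$ where the right-hand sides are understood as their power series expansions in $w$ at $w=0$.
   Context: Parameters: $\alpha_1,\dots,\alpha_p\in\mathbb{C}$ and real $\beta_1,\dots,\beta_q>-1$. The complex variable $c$ ranges over: all of $\mathbb{C}$ if $p<q+1$; $|c|<1$ if $p=q+1$; and, if $p>q+1$, it is assumed that one or more of the $\alpha_i$ is a negative integer $-N$ with $N\in\mathbb{N}$ (so that all sums below are finite), and $c\ne 0$. Pochhammer symbol: $(a)_0=1$, $(a)_x=a(a+1)\cdots(a+x-1)$ for $x\in\mathbb{N}$. Moments: for $n=0,1,\dots$, $$\mu_n(c)=\sum_{x=0}^{\infty}x^n\,\frac{(\alpha_1)_x\cdots(\alpha_p)_x}{(\beta_1+1)_x\cdots(\beta_q+1)_x}\,\frac{c^x}{x!},$$ with the convention $0^0=1$. Put $\xi=\max\{p-1,q\}$ and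 $\vec{\mu}(c)=(\mu_0(c),\dots,\mu_\xi(c))^T$. $(\lambda,\tau)=(1,0)$ if $q+1>p$; $(\lambda,\tau)=(1,-1)$ if $q+1=p$; $(\lambda,\tau)=(0,1)$ if $q+1<p$. Coefficients $\sigma_0(c),\dots,\sigma_\xi(c)$ are defined by the polynomial identity in an indeterminate $T$ $$T(T+\beta_1)\cdots(T+\beta_q)-c(T+\alpha_1)\cdots(T+\alpha_p)=\varepsilon\left[(\lambda+c\tau)T^{\xi+1}-\sum_{k=0}^{\xi}\sigma_k(c)T^k\right],$$ where $\varepsilon=1$ if $q+1\ge p$ and $\varepsilon=-1$ if $q+1<p$ (empty products equal $1$). The $(\xi+1)\times(\xi+1)$ matrix $\mathbf{M}(c)$, with rows and columns indexed by $0,1,\dots,\xi$: $\mathbf{M}_{\xi,j}=\sigma_j(c)$ for $0\le j\le\xi$; $\mathbf{M}_{i,i+1}=\lambda+c\tau$ for $0\le i\le\xi-1$; all other entries are $0$. The $(\xi+1)$-vector polynomials $\vec{P}_n(c)$ are defined by $\vec{P}_0(c)=(1,0,\dots,0)^T$ and $$\vec{P}_{n+1}=c(\lambda+c\tau)\frac{d\vec{P}_n}{dc}+\left(\mathbf{M}^T-n\tau c\,\mathbf{I}\right)\vec{P}_n,\qquad n=0,1,\dots,$$ with $\mathbf{I}$ the identity matrix. The dot denotes $\vec{u}\cdot\vec{v}=\sum_i u_iv_i$ (no complex conjugation). *)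

(* Defs.v *)
From HB Require Import structures.
From mathcomp Require Import all_boot all_order all_algebra.
From mathcomp Require Import complex.
From mathcomp Require Import all_classical all_reals all_analysis.
Set Implicit Arguments.
Unset Strict Implicit.
Unset Printing Implicit Defensive.
Import Order.TTheory GRing.Theory Num.Theory.
Import numFieldNormedType.Exports.
Local Open Scope classical_set_scope.
Local Open Scope ring_scope.
Local Open Scope complex_scope.

(* The topology of the complex numbers is reached through the regular module
   [R[i]^o], which is a normed module over the numeric field [R[i]]. *)

Definition csum {R : realType} (u : nat -> R[i]) : R[i] :=
  lim (series (u : nat -> R[i]^o) @ \oo).

Definition expC {R : realType} (z : R[i]) : R[i] :=
  csum (fun k => z ^+ k / k`!%:R).

(* Formal power series in [w] are encoded by their coefficient sequences.
   [is_expansion0 f a]: [f] is analytic at [0] and its power series expansion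
   there is [\sum_n a n w ^ n]. *)
Definition is_expansion0 {R : realType} (f : R[i] -> R[i]) (a : nat -> R[i]) :
    Prop :=
  \forall w \near (0 : R[i]^o),
    series (fun n => a n * w ^+ n : R[i]^o) @ \oo --> (f w : R[i]^o).

Definition pochhammer {A : pzRingType} (a : A) (x : nat) : A :=
  \prod_(k < x) (a + k%:R).

(* [0 ^+ 0 = 1], for [x ^ n] as well as for [c ^ x]. *)
Definition mu {R : realType} {p q : nat} (alpha : 'I_p -> R[i])
    (beta : 'I_q -> R) (n : nat) (c : R[i]) : R[i] :=
  csum (fun x : nat => x%:R ^+ n *
    ((\prod_(i < p) pochhammer (alpha i) x) /
     (\prod_(j < q) pochhammer ((beta j)%:C + 1) x)) * (c ^+ x / x`!%:R)).

(* When [p = 0] the truncated predecessor gives the correct value [q]. *)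
Definition xi (p q : nat) : nat := maxn p.-1 q.

Definition lambda (p q : nat) : int := if (p <= q.+1)%N then 1 else 0.

Definition tau (p q : nat) : int :=
  if (p < q.+1)%N then 0 else if p == q.+1 then - 1 else 1.

Definition eps (p q : nat) : int := if (p <= q.+1)%N then 1 else - 1.

(* [sigma k], the matrix [M] and the vectors [P n] are polynomials in [c]:
   the indeterminate of [{poly R[i]}] is [c]. *)

(* [lambda + c * tau] *)
Definition lead {R : realType} (p q : nat) : {poly R[i]} :=
  (lambda p q)%:~R + 'X * (tau p q)%:~R.

(* The outer indeterminate is [T], the inner one is [c]. *)
Definition Tpoly {R : realType} {p q : nat} (alpha : 'I_p -> R[i])
    (beta : 'I_q -> R) : {poly {poly R[i]}} :=
  'X * \prod_(j < q) ('X + ((beta j)%:C)%:P%:P)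
  - 'X%:P * \prod_(i < p) ('X + (alpha i)%:P%:P).

(* Since [eps = eps^-1], these are the coefficients singled out by the identity
   in [T]; see [sigmaP]. *)
Definition sigma {R : realType} {p q : nat} (alpha : 'I_p -> R[i])
    (beta : 'I_q -> R) (k : nat) : {poly R[i]} :=
  - ((eps p q)%:~R * (Tpoly alpha beta)`_k).

Definition Mmx {R : realType} {p q : nat} (alpha : 'I_p -> R[i])
    (beta : 'I_q -> R) : 'M[{poly R[i]}]_((xi p q).+1) :=
  \matrix_(i, j)
    if i == xi p q :> nat then sigma alpha beta j
    else if j == i.+1 :> nat then lead p q else 0.

Fixpoint Pvec {R : realType} {p q : nat} (alpha : 'I_p -> R[i])
    (beta : 'I_q -> R) (n : nat) : 'cV[{poly R[i]}]_((xi p q).+1) :=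
  if n is m.+1 then
    let P := Pvec alpha beta m in
    ('X * lead p q) *: map_mx (@deriv R[i]) P
    + ((Mmx alpha beta)^T - (m%:R * (tau p q)%:~R * 'X)%:M) *m P
  else \col_i (i == ord0)%:R.

Definition Gmu {R : realType} {p q : nat} (alpha : 'I_p -> R[i])
    (beta : 'I_q -> R) (c : R[i]) : nat -> R[i] :=
  fun n => mu alpha beta n c / n`!%:R.

Definition GP {R : realType} {p q : nat} (alpha : 'I_p -> R[i])
    (beta : 'I_q -> R) (c : R[i]) : nat -> 'cV[R[i]]_((xi p q).+1) :=
  fun n => \col_i ((Pvec alpha beta n i ord0).[c] / n`!%:R).

Definition muvec {R : realType} {p q : nat} (alpha : 'I_p -> R[i])
    (beta : 'I_q -> R) (c : R[i]) : 'cV[R[i]]_((xi p q).+1) :=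
  \col_i mu alpha beta i c.

Definition dotv {A : pzRingType} {n : nat} (u v : 'cV[A]_n) : A :=
  \sum_i u i ord0 * v i ord0.

Lemma epsK {A : nzRingType} (p q : nat) :
  (eps p q)%:~R * (eps p q)%:~R = 1 :> A.
Proof. by rewrite /eps; case: ifP; rewrite ?rmorphN ?mulrNN mulr1. Qed.

Section Sigma.
Variables (R : realType) (p q : nat).
Variables (alpha : 'I_p -> R[i]) (beta : 'I_q -> R).

Let monic_prod n (f : 'I_n -> {poly R[i]}) :
  \prod_(i < n) ('X + (f i)%:P) \is monic
  /\ size (\prod_(i < n) ('X + (f i)%:P)) = n.+1.
Proof.
have -> : \prod_(i < n) ('X + (f i)%:P) = \prod_(i < n) ('X - (- f i)%:P).
  by apply: eq_bigr => i _; rewrite polyCN opprK.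
by rewrite (monic_prod_XsubC _ xpredT) size_prod_XsubC /index_enum -enumT
  size_enum_ord.
Qed.

Lemma Tpoly_lead :
  (Tpoly alpha beta)`_(xi p q).+1 = (eps p q)%:~R * lead p q.
Proof.
have [/monicP mb sb] := monic_prod (fun j : 'I_q => ((beta j)%:C)%:P).
have [/monicP ma sa] := monic_prod (fun i : 'I_p => (alpha i)%:P).
move: ma mb; rewrite !lead_coefE sa sb /= => ma mb.
rewrite coefB coefXM coefCM /= /lead /eps /lambda /tau /xi.
case: (ltngtP p q.+1) => h.
- have -> : maxn p.-1 q = q by apply/maxn_idPr; case: (p) h => //= n /ltnW.
  by rewrite mb nth_default ?sa // mulr0 subr0 addr0 mulr1.
- have pE : p.-1.+1 = p by apply: ltn_predK h.
  have -> : maxn p.-1 q = p.-1 by apply/maxn_idPl; rewrite -ltnS pE ltnW.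
  rewrite pE ma nth_default; last by rewrite sb -ltnS pE.
  by rewrite sub0r add0r !mulr1 rmorphN1 mulN1r.
have -> : maxn p.-1 q = q by rewrite h maxnn.
by rewrite mb -{1}h ma rmorphN1 mul1r mulrN !mulr1.
Qed.

Lemma Tpoly_size : (size (Tpoly alpha beta) <= (xi p q).+2)%N.
Proof.
have [_ sb] := monic_prod (fun j : 'I_q => ((beta j)%:C)%:P).
have [_ sa] := monic_prod (fun i : 'I_p => (alpha i)%:P).
apply: (leq_trans (size_polyD _ _)); rewrite size_polyN geq_max.
apply/andP; split.
  apply: (leq_trans (size_polyMleq _ _)).
  by rewrite size_polyX sb /= !ltnS leq_maxr.
rewrite mul_polyC; apply: (leq_trans (size_scale_leq _ _)).
by rewrite sa ltnS; apply: (leq_trans (leqSpred _)); rewrite ltnS leq_maxl.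
Qed.

Lemma sigmaP (s : 'I_(xi p q).+1 -> {poly R[i]}) :
  Tpoly alpha beta =
    (eps p q)%:~R *
      ((lead p q)%:P * 'X^((xi p q).+1)
       - \sum_(k < (xi p q).+1) (s k)%:P * 'X^k)
  <-> forall k, s k = sigma alpha beta k.
Proof.
have cf k : ((eps p q)%:~R *
      ((lead p q)%:P * 'X^((xi p q).+1)
       - \sum_(k < (xi p q).+1) (s k)%:P * 'X^k) : {poly {poly R[i]}})`_k =
    (eps p q)%:~R * (lead p q * (k == (xi p q).+1)%:R
       - \sum_(j < (xi p q).+1) s j * (k == j)%:R).
  rewrite -[(eps p q)%:~R](rmorph_int polyC) coefCM coefB coefCM coefXn.
  congr (_ * (_ - _)); rewrite coef_sum.
  by apply: eq_bigr => j _; rewrite coefCM coefXn.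
have cs (k : 'I_(xi p q).+1) : \sum_(j < (xi p q).+1) s j * (k == j :> nat)%:R = s k.
  rewrite (bigD1 k) //= eqxx mulr1 big1 ?addr0 // => j /negPf jk.
  by rewrite eq_sym -val_eqE in jk; rewrite jk mulr0.
split=> [E k|E].
  rewrite /sigma E cf cs ltn_eqF // mulr0 sub0r mulrN mulrN opprK.
  by rewrite mulrA epsK mul1r.
apply/polyP => k; rewrite cf.
case: (ltngtP k (xi p q).+1) => h.
- rewrite (cs (Ordinal h)) E /sigma /= mulr0 sub0r opprK.
  by rewrite mulrA epsK mul1r.
- rewrite nth_default ?(leq_trans Tpoly_size) // mulr0 sub0r.
  by rewrite big1 ?oppr0 ?mulr0 // => j _; rewrite gtn_eqF ?mulr0 // (ltn_trans _ h).
rewrite h Tpoly_lead mulr1 big1 ?subr0 // => j _.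
by rewrite gtn_eqF ?mulr0.
Qed.

End Sigma.

(* Main.v *)
Require Import Defs.
From mathcomp Require Import all_boot all_order all_algebra.
From mathcomp Require Import complex.
From mathcomp Require Import all_classical all_reals all_analysis.
From mathcomp Require Import ring lra zify.
Set Implicit Arguments.
Unset Strict Implicit.
Unset Printing Implicit Defensive.
Import Order.TTheory GRing.Theory Num.Theory.
Import numFieldNormedType.Exports.
Import Normc.
Local Open Scope classical_set_scope.
Local Open Scope ring_scope.
Local Open Scope complex_scope.

(** Let [h x] be the coefficient of [c ^ x] in [mu_0], so that
    [mu_n(c) = \sum_x x ^ n * h x * c ^ x].

    The first expansion is an exchange of summations:
    [mu_0(c e^w) = \sum_x h x * c ^ x * e^(x w)], and expanding [e^(x w)] and
    summing over [x] first gives [\sum_n mu_n(c) * w ^ n / n!].  The exchange is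
    legitimate because [\sum_x |h x| * rho ^ x] converges for some
    [rho > |c|] ([hcoef_summable], by the ratio test) and
    [|c| * e^|w| <= rho] for small [w].  This needs a Fubini theorem for complex
    double series ([double_sum_abs]) and the identity
    [(e^w) ^ x = \sum_n (x w) ^ n / n!] ([sums_to_expCX]), which comes from the
    Cauchy product ([sums_to_cauchy]).

    The second expansion is the first one with [w] replaced by [L w], where
    [L = lambda + tau c], once it is known that
    [P_n(c) . mu(c) = L ^ n * mu_n(c)].  With [theta = c d/dc] one has
    [theta mu_n = mu_(n+1)], and the hypergeometric equation satisfied by [mu_0]
    says that [\sum_j sigma_j mu_j = L mu_(xi+1)], that is,
    [M mu = L theta mu].  Differentiating [P_n . mu = L ^ n * mu_n] and
    inserting the recurrence of [P_n] gives the next case.  This induction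
    concerns only power series in [c], and is carried out on polynomials modulo
    ['X^N]: the truncations [trunc_mu N n] of the [mu_n] satisfy
    [theta mu_n = mu_(n+1)] exactly ([trunc_muS]) and the
    hypergeometric equation modulo ['X^N] ([sigma_recurrence]), which gives
    [Pvec_moments] for every [N], hence an equality of coefficients.
    [Pvec_dot_muvec] evaluates it at [c], so that no complex derivative is
    ever taken. *)

(** * Sums of series *)

Definition sums_to {K : numFieldType} (u : nat -> K) (s : K) : Prop :=
  series (u : nat -> K^o) @ \oo --> (s : K^o).

Section SumsTo.
Variable K : numFieldType.
Implicit Types (u v : nat -> K) (s t : K).

Lemma sums_to_unique u s t : sums_to u s -> sums_to u t -> s = t.
Proof. exact: (@cvg_unique _ (@norm_hausdorff K K^o)). Qed.

Lemma eq_sums_to u v s : u =1 v -> sums_to u s -> sums_to v s.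
Proof. by move=> /funext ->. Qed.

Lemma sums_toD u v s t :
  sums_to u s -> sums_to v t -> sums_to (fun n => u n + v n) (s + t).
Proof.
move=> us vt; rewrite /sums_to.
have -> : series ((fun n => u n + v n) : nat -> K^o)
        = series (u : nat -> K^o) + series (v : nat -> K^o).
  by rewrite -seriesD.
exact: cvgD.
Qed.

Lemma sums_toZ k u s : sums_to u s -> sums_to (fun n => k * u n) (k * s).
Proof.
move=> us; rewrite /sums_to.
have -> : series ((fun n => k * u n) : nat -> K^o)
        = k *: series (u : nat -> K^o).
  by rewrite -seriesZ.
exact: (@cvgZl_tmp _ _ _ _ _ k _ (s : K^o)).
Qed.

Lemma sums_to0 : sums_to (fun=> 0 : K) 0.
Proof.
rewrite /sums_to (_ : series _ = cst 0); first exact: cvg_cst.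
by apply/funext => n; rewrite /series /= big1.
Qed.

Lemma sums_to_sum (I : Type) (r : seq I) (F : I -> nat -> K) (S : I -> K) :
  (forall i, sums_to (F i) (S i)) ->
  sums_to (fun n => \sum_(i <- r) F i n) (\sum_(i <- r) S i).
Proof.
move=> FS; elim: r => [|i r IH].
  by rewrite big_nil; apply: eq_sums_to sums_to0 => n; rewrite big_nil.
rewrite big_cons; apply: eq_sums_to (sums_toD (FS i) IH) => n.
by rewrite big_cons.
Qed.

(** Multiplication by ['X] of the series with coefficients [u]. *)
Definition delay u n : K := if n is m.+1 then u m else 0.

Lemma sums_to_delay u s : sums_to u s -> sums_to (delay u) s.
Proof.
move=> us; rewrite /sums_to -cvg_shiftS.
rewrite (_ : [sequence _]_n = series (u : nat -> K^o)) //.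
apply/funext => n; rewrite /series /= !big_mkord big_ord_recl add0r.
by apply: eq_bigr.
Qed.

End SumsTo.

(** * Exchange of summations *)

Section Fubini.
Variable R : realType.

Definition double_sum (K : numFieldType) (f : nat -> nat -> K) : Prop :=
  exists s t S, [/\ forall x, sums_to (f x) (s x),
    forall n, sums_to (f^~ n) (t n), sums_to s S & sums_to t S].

Lemma double_sumD (K : numFieldType) (f g : nat -> nat -> K) :
  double_sum f -> double_sum g -> double_sum (fun x n => f x n + g x n).
Proof.
move=> [s [t [S [fs ft sS tS]]]] [s' [t' [S' [gs gt sS' tS']]]].
exists (fun x => s x + s' x), (fun n => t n + t' n), (S + S').
by split=> [x|n||]; apply: sums_toD.
Qed.

Lemma double_sumZ (K : numFieldType) k (f : nat -> nat -> K) :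
  double_sum f -> double_sum (fun x n => k * f x n).
Proof.
move=> [s [t [S [fs ft sS tS]]]].
exists (fun x => k * s x), (fun n => k * t n), (k * S).
by split=> [x|n||]; apply: sums_toZ.
Qed.

Lemma sums_to_bounded (u : nat -> R) B : (forall n, 0 <= u n) ->
  (forall N, \sum_(n < N) u n <= B) -> exists s, sums_to u s.
Proof.
move=> u0 uB; exists (limn (series u)).
apply: nondecreasing_is_cvgn.
  apply/nondecreasing_seqP => n; rewrite seriesSr lerDl; exact: u0.
by exists B => _ [n _ <-]; rewrite /series /= big_mkord; apply: uB.
Qed.

Lemma sums_to_le (u : nat -> R) s B :
  sums_to u s -> (forall N, \sum_(n < N) u n <= B) -> s <= B.
Proof.
move=> us uB; apply: (@cvgr_to_le _ _ _ R (series u) s B us).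
by apply: nearW => n; rewrite /series /= big_mkord.
Qed.

Lemma sums_to_ge (u : nat -> R) s N : (forall n, 0 <= u n) ->
  sums_to u s -> \sum_(n < N) u n <= s.
Proof.
move=> u0 us.
have nd : nondecreasing_seq (series u).
  apply/nondecreasing_seqP => n; rewrite seriesSr lerDl; exact: u0.
have cv : cvgn (series u) by apply/cvg_ex; exists s.
have := nondecreasing_cvgn_le nd cv N.
rewrite /series /= big_mkord => /le_trans; apply.
by rewrite (cvg_lim _ us).
Qed.

(** For nonnegative terms each iterated sum is the supremum of the finite
    rectangular sums, so that each of them bounds the other one. *)
Lemma double_sum_nneg (f : nat -> nat -> R) B : (forall x n, 0 <= f x n) ->
  (forall X N, \sum_(x < X) \sum_(n < N) f x n <= B) -> double_sum f.
Proof.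
move=> f0 fB.
have row x : exists s, sums_to (f x) s.
  apply: (@sums_to_bounded _ B) => // N; apply: le_trans (fB x.+1 N).
  by rewrite big_ord_recr /= lerDr sumr_ge0 // => i _; apply: sumr_ge0.
have col n : exists t, sums_to (f^~ n) t.
  apply: (@sums_to_bounded _ B) => // X; apply: le_trans (fB X n.+1).
  apply: ler_sum => x _.
  by rewrite big_ord_recr /= lerDr; apply: sumr_ge0.
have /choice [s fs] := row; have /choice [t ft] := col.
have fin X : sums_to (fun n => \sum_(x < X) f x n) (\sum_(x < X) s x).
  by apply: sums_to_sum.
have fin' N : sums_to (fun x => \sum_(n < N) f x n) (\sum_(n < N) t n).
  by apply: (@sums_to_sum _ _ _ (fun (n : 'I_N) x => f x n)) => n; apply: ft.
have s0 x : 0 <= s x by have := sums_to_ge 0 (f0 x) (fs x); rewrite big_ord0.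
have t0 n : 0 <= t n.
  by have := sums_to_ge 0 (fun x => f0 x n) (ft n); rewrite big_ord0.
have [S sS] : exists S, sums_to s S.
  apply: (@sums_to_bounded _ B) => // X; apply: sums_to_le (fin X) _ => N.
  by rewrite exchange_big.
have [T tT] : exists T, sums_to t T.
  apply: (@sums_to_bounded _ B) => // N; apply: sums_to_le (fin' N) _ => X.
  exact: fB.
have ST : S = T.
  apply/eqP; rewrite eq_le; apply/andP; split.
    apply: sums_to_le sS _ => X; apply: sums_to_le (fin X) _ => N.
    apply: le_trans (sums_to_ge N t0 tT); apply: ler_sum => n _.
    exact: sums_to_ge (ft n).
  apply: sums_to_le tT _ => N; apply: sums_to_le (fin' N) _ => X.
  apply: le_trans (sums_to_ge X s0 sS); apply: ler_sum => x _.
  exact: sums_to_ge (fs x).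
by exists s, t, S; split => //; rewrite ST.
Qed.

(** A positive complex number is real, so that the entourages of the complex
    topology are indexed by positive reals. *)
Lemma sums_toC (u : nat -> R) s : sums_to u s ->
  sums_to (fun n => (u n)%:C) s%:C.
Proof.
move=> us; apply/(@cvgrPdist_lt _ (R[i]^o)) => e.
rewrite ltcE /= => /andP[/eqP e1 e2].
have /(@cvgrPdist_lt _ R^o) /(_ (complex.Re e) e2) := us.
apply: filterS => n.
rewrite -[X in _ -> _ < X](RRe_real (gtr0_real _)); last first.
  by rewrite ltcE /= e1 eqxx.
have -> : series ((fun n => (u n)%:C) : nat -> R[i]^o) n = (series u n)%:C.
  by rewrite /series /= rmorph_sum.
move=> H; rewrite -rmorphB /= normc_def /= expr0n addr0 sqrtr_sqr ltcR.
exact: H.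
Qed.

Lemma double_sumC (f : nat -> nat -> R) :
  double_sum f -> double_sum (fun x n => (f x n)%:C).
Proof.
move=> [s [t [S [fs ft sS tS]]]].
exists (fun x => (s x)%:C), (fun n => (t n)%:C), S%:C.
split=> [x|n||]; exact: sums_toC.
Qed.

Lemma normc_ge0 (z : R[i]) : 0 <= normc z.
Proof. by case: z => a b; apply: sqrtr_ge0. Qed.

Lemma normc_ge_abs (z : R[i]) :
  `|complex.Re z| <= normc z /\ `|complex.Im z| <= normc z.
Proof.
case: z => a b /=; rewrite -!sqrtr_sqr; split; apply: ler_wsqrtr.
  by rewrite lerDl sqr_ge0.
by rewrite lerDr sqr_ge0.
Qed.

(** Reduction to nonnegative real terms: a complex number is a combination of
    its real and imaginary parts, and a real number [g] is
    [|g| - 2 * ((|g| - g) / 2)], where [|g|] and the negative part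
    [(|g| - g) / 2] of [g] are dominated by the modulus.  Convergence of the
    iterated sums is obtained at the same time, from the monotone real case. *)
Theorem double_sum_abs (f : nat -> nat -> R[i]) B :
  (forall X N, \sum_(x < X) \sum_(n < N) normc (f x n) <= B) -> double_sum f.
Proof.
move=> fB.
have dom (g : nat -> nat -> R) : (forall x n, 0 <= g x n <= normc (f x n)) ->
    double_sum (fun x n => (g x n)%:C).
  move=> gf; apply: double_sumC; apply: (@double_sum_nneg _ B).
    by move=> x n; case/andP: (gf x n).
  move=> X N; apply: le_trans (fB X N).
  by apply: ler_sum => x _; apply: ler_sum => n _; case/andP: (gf x n).
have dom' (g : nat -> nat -> R) : (forall x n, `|g x n| <= normc (f x n)) ->
    double_sum (fun x n => (g x n)%:C).
  move=> gf.
  have P : double_sum (fun x n => (`|g x n|)%:C).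
    by apply: dom => x n; rewrite normr_ge0 /=.
  have Q : double_sum (fun x n => ((`|g x n| - g x n) / 2)%:C).
    apply: dom => x n; have := gf x n; have := ler_norm (g x n).
    have := lerNnormlW (lexx `|g x n|) => ? ? ?; apply/andP; split; lra.
  have := double_sumD P (double_sumZ (- 2) Q); congr double_sum.
  apply/funext => x; apply/funext => n.
  have -> : - 2 = (- 2)%:C :> R[i] by rewrite rmorphN /= rmorphMn.
  by rewrite -rmorphM -rmorphD /=; congr (_%:C); field.
have := double_sumD (dom' (fun x n => complex.Re (f x n)) _)
  (double_sumZ 'i%C (dom' (fun x n => complex.Im (f x n)) _)).
rewrite (_ : (fun x n => _) = f); last first.
  by apply/funext => x; apply/funext => n; rewrite -complexE.
by apply=> x n; case: (normc_ge_abs (f x n)).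
Qed.

End Fubini.

(** * The complex exponential *)

Section Exponential.
Variable R : realType.
Implicit Types (u : nat -> R[i]) (w z : R[i]).

Lemma normcE z : `|z| = (normc z)%:C.
Proof. by case: z. Qed.

Lemma normcX z n : normc (z ^+ n) = normc z ^+ n.
Proof. by elim: n => [|n IH]; rewrite ?normc1 // !exprS normcM IH. Qed.

Lemma normc_nneg (a : R) : 0 <= a -> normc a%:C = a.
Proof. by move=> a0; rewrite /normc /= expr0n addr0 sqrtr_sqr ger0_norm. Qed.

Lemma normc_nat n : normc (n%:R : R[i]) = n%:R.
Proof. by rewrite -(rmorph_nat (real_complex R)) normc_nneg. Qed.

Lemma normc_prod (I : Type) (r : seq I) (F : I -> R[i]) :
  normc (\prod_(i <- r) F i) = \prod_(i <- r) normc (F i).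
Proof.
elim: r => [|i r IH]; first by rewrite !big_nil normc1.
by rewrite !big_cons normcM IH.
Qed.

Lemma sums_to_abs u B :
  (forall N, \sum_(n < N) normc (u n) <= B) -> exists s, sums_to u s.
Proof.
move=> uB.
have [|s [_ [_ [us _ _ _]]]] :=
    @double_sum_abs R (fun x n => if x == 0%N then u n else 0) B.
  case=> [|X] N.
    by rewrite big_ord0; have := uB 0%N; rewrite big_ord0.
  rewrite big_ord_recl /= [X in _ + X]big1 ?addr0; first exact: uB.
  by move=> i _; rewrite big1 // => j _; exact: normc0.
by exists (s 0%N); apply: us.
Qed.

Lemma csumE u s : sums_to u s -> csum u = s.
Proof. exact: (@cvg_lim _ (@norm_hausdorff _ (R[i]^o))). Qed.

Lemma sum_exp_coeff_le (x : R) N :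
  0 <= x -> \sum_(n < N) x ^+ n / n`!%:R <= expR x.
Proof.
move=> x0; have cv := @is_cvg_series_exp_coeff R x.
apply: (@sums_to_ge _ (exp_coeff x)) => //.
by move=> n; apply: exp_coeff_ge0.
Qed.

Lemma normc_exp_coeff w n :
  normc (w ^+ n / n`!%:R) = normc w ^+ n / n`!%:R.
Proof. by rewrite normcM normcV normcX normc_nat. Qed.

Lemma sum_normc_exp_coeff_le w N :
  \sum_(n < N) normc (w ^+ n / n`!%:R) <= expR (normc w).
Proof.
apply: le_trans (sum_exp_coeff_le N (normc_ge0 w)).
by apply: ler_sum => n _; rewrite normc_exp_coeff.
Qed.

Lemma sums_to_expC w : sums_to (fun n => w ^+ n / n`!%:R) (expC w).
Proof.
have [s us] := @sums_to_abs (fun n => w ^+ n / n`!%:R) _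
    (sum_normc_exp_coeff_le w).
by rewrite /expC (csumE us).
Qed.

Lemma iter_delayE (K : numFieldType) (v : nat -> K) j n :
  iter j (@delay K) v n = if (j <= n)%N then v (n - j)%N else 0.
Proof.
elim: j n => [|j IH] n /=; first by rewrite subn0.
by case: n => [|n] //=; rewrite IH ltnS subSS.
Qed.

Lemma sums_to_iter_delay (K : numFieldType) (v : nat -> K) s j :
  sums_to v s -> sums_to (iter j (@delay K) v) s.
Proof. by move=> vs; elim: j => //= j; apply: sums_to_delay. Qed.

Lemma sum_delay_le (v : nat -> R) j N : (forall n, 0 <= v n) ->
  \sum_(n < N) iter j (@delay R) v n <= \sum_(n < N) v n.
Proof.
move=> v0; elim: j => // j IH; apply: le_trans IH.
case: N => [|N]; first by rewrite !big_ord0.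
rewrite big_ord_recl [leRHS]big_ord_recr /= add0r lerDl iter_delayE.
by case: ifP.
Qed.

(** Fubini for the array whose row [j] is [u j] times the sequence [v] delayed
    by [j]: its column sums are the terms of the Cauchy product. *)
Theorem sums_to_cauchy (u v : nat -> R[i]) s t A B :
  (forall N, \sum_(n < N) normc (u n) <= A) ->
  (forall N, \sum_(n < N) normc (v n) <= B) ->
  sums_to u s -> sums_to v t ->
  sums_to (fun n => \sum_(j < n.+1) u j * v (n - j)%N) (s * t).
Proof.
move=> uA vB us vt.
pose f j n := u j * iter j (@delay R[i]) v n.
have [|s' [t' [S [fs ft sS tS]]]] := @double_sum_abs R f (A * B).
  move=> X N; apply: le_trans (_ : \sum_(x < X) normc (u x) * B <= _).
    apply: ler_sum => j _.
    apply: le_trans (_ : \sum_(n < N) normc (u j) *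
        iter j (@delay R) (fun n => normc (v n)) n <= _).
      apply: ler_sum => n _; rewrite /f normcM !iter_delayE.
      by case: ifP => // _; rewrite normc0.
    rewrite -mulr_sumr; apply: ler_wpM2l; first exact: normc_ge0.
    apply: le_trans (vB N); apply: sum_delay_le => n; exact: normc_ge0.
  rewrite -mulr_suml; apply: ler_wpM2r; last exact: uA.
  by have := vB 0%N; rewrite big_ord0.
have s'E j : s' j = t * u j.
  rewrite mulrC; apply: sums_to_unique (fs j) _.
  exact/sums_toZ/sums_to_iter_delay.
have SE : S = s * t.
  apply: sums_to_unique sS _; rewrite mulrC.
  by apply: eq_sums_to (sums_toZ us) => j; rewrite s'E.
rewrite -SE; apply: eq_sums_to tS => n; apply: sums_to_unique (ft n) _.
rewrite /sums_to; apply: cvg_near_cst; near=> N.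
rewrite /series /= big_mkord.
have nN : (n < N)%N by near: N; exact: nbhs_infty_gt.
rewrite (big_ord_widen N (fun j => u j * v (n - j)%N) nN).
rewrite [LHS](bigID (fun j : 'I_N => (j < n.+1)%N)) /=.
rewrite [X in _ + X]big1 ?addr0; last first.
  by move=> j nj; rewrite /f iter_delayE -ltnS (negbTE nj) mulr0.
by apply: eq_bigr => j jn; rewrite /f iter_delayE -ltnS jn.
Unshelve. all: by end_near.
Qed.

(** Induction on [x]: by the binomial formula, the Cauchy product of the series
    of [w] and [x w] is the series of [(x + 1) w]. *)
Lemma sums_to_expCX w x :
  sums_to (fun n => (x%:R * w) ^+ n / n`!%:R) (expC w ^+ x).
Proof.
elim: x => [|x IH].
  rewrite expr0 mul0r /sums_to; apply: cvg_near_cst; near=> N.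
  have N0 : (0 < N)%N by near: N; exact: nbhs_infty_gt.
  rewrite /series /= big_mkord -(prednK N0) big_ord_recl expr0 divr1.
  by rewrite big1 ?addr0 // => i _; rewrite expr0n mul0r.
rewrite exprS.
apply: eq_sums_to (sums_to_cauchy (sum_normc_exp_coeff_le w)
  (sum_normc_exp_coeff_le (x%:R * w)) (@sums_to_expC w) IH) => n.
rewrite -nat1r mulrDl mul1r [w + _]addrC exprDn mulr_suml.
apply: eq_bigr => j _.
have jn : (j <= n)%N by rewrite -ltnS.
have f0 m : m`!%:R != 0 :> R[i] by rewrite pnatr_eq0 -lt0n fact_gt0.
apply: (mulIf (f0 n)); rewrite mulfVK // -(bin_fact jn) !natrM mulr_natr.
by rewrite -mulr_natr; field; rewrite !f0.
Unshelve. all: by end_near.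
Qed.

End Exponential.

(** * Growth of the hypergeometric coefficients *)

Section Growth.
Variable R : realType.

(** From the rank [N0] where the ratio bound holds, the quantity
    [\sum_(n < N) v n + v N / (1 - k)] decreases with [N]. *)
Lemma ratio_bounded (v : nat -> R) k : (forall n, 0 <= v n) -> 0 <= k < 1 ->
  (\forall n \near \oo, v n.+1 <= k * v n) ->
  exists B, forall N, \sum_(n < N) v n <= B.
Proof.
move=> v0 /andP[k0 k1] [N0 _ vk].
have k1' : 0 < 1 - k by rewrite subr_gt0.
pose B := \sum_(n < N0) v n + v N0 / (1 - k).
have inv m : \sum_(n < N0 + m) v n + v (N0 + m)%N / (1 - k) <= B.
  elim: m => [|m IH]; first by rewrite addn0.
  apply: le_trans IH; rewrite addnS big_ord_recr /= -addrA lerD2l.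
  have /= := vk (N0 + m)%N (leq_addr _ _).
  set a := v (N0 + m)%N; set b := v _ => bk.
  rewrite -lerBrDl.
  have -> : a / (1 - k) - a = k * a / (1 - k) by field; rewrite gt_eqF.
  by rewrite ler_pM2r ?invr_gt0.
exists B => N; apply: le_trans (inv N).
have /(_ (N0 + N)%N N) : forall M m, (m <= M)%N ->
    \sum_(n < m) v n <= \sum_(n < M) v n.
  move=> M m /subnKC <-; rewrite big_split_ord /= lerDl; exact: sumr_ge0.
by move=> /(_ (leq_addl _ _)) /le_trans; apply; rewrite lerDl divr_ge0 // ltW.
Qed.

Lemma cvgM_eq (f g : nat -> R) (a b l : R) : a * b = l ->
  f x @[x --> \oo] --> a -> g x @[x --> \oo] --> b ->
  (f x * g x) @[x --> \oo] --> l.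
Proof. by move=> <-; apply: cvgM. Qed.

Lemma cvg_prod_one (n : nat) (F : 'I_n -> nat -> R) :
  (forall i, F i x @[x --> \oo] --> (1 : R)) ->
  (\prod_i F i x) @[x --> \oo] --> (1 : R).
Proof.
elim: n F => [|n IH] F Fl.
  under eq_fun do rewrite big_ord0; exact: cvg_cst.
under eq_fun do rewrite big_ord_recl.
apply: cvgM_eq (mulr1 1) _ _; first exact: Fl.
by apply: IH => i; apply: Fl.
Qed.

Lemma cvg_shift_ratio (a : R) :
  ((a + x%:R) / x.+1%:R) @[x --> \oo] --> (1 : R).
Proof.
rewrite (_ : (fun x : nat => _) =
            (fun x : nat => 1 + (a - 1) * harmonic x)); last first.
  apply/funext => x /=.
  have x0 : x%:R + 1 != 0 :> R by rewrite natr1 pnatr_eq0.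
  by rewrite -natr1; field.
suff : (1 + (a - 1) * harmonic x) @[x --> \oo] --> 1 + (a - 1) * 0.
  by rewrite mulr0 addr0.
apply: cvgD; first exact: cvg_cst.
by apply: cvgM; [exact: cvg_cst|exact: cvg_harmonic].
Qed.

Lemma cvg_shift_ratio_inv (b : R) :
  (x.+1%:R / (b + x%:R)) @[x --> \oo] --> (1 : R).
Proof.
rewrite (_ : (fun x : nat => _) = (fun x : nat => ((b + x%:R) / x.+1%:R)^-1)).
  suff : ((b + x%:R) / x.+1%:R)^-1 @[x --> \oo] --> (1^-1 : R) by rewrite invr1.
  by apply: cvgV; [exact: oner_neq0 | exact: cvg_shift_ratio].
by apply/funext => x; rewrite invf_div.
Qed.

End Growth.

Section Coefficients.
Variables (R : realType) (p q : nat) (alpha : 'I_p -> R[i]) (beta : 'I_q -> R).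

(** The Taylor coefficients of [mu alpha beta 0]. *)
Definition hcoef (x : nat) : R[i] :=
  (\prod_(i < p) pochhammer (alpha i) x) /
  (\prod_(j < q) pochhammer ((beta j)%:C + 1) x) / x`!%:R.

Lemma pochhammerS (A : pzRingType) (a : A) x :
  pochhammer a x.+1 = pochhammer a x * (a + x%:R).
Proof. by rewrite /pochhammer big_ord_recr. Qed.

Hypothesis hbeta : forall j, - 1 < beta j.

Lemma beta_shift_gt0 j x : 0 < beta j + 1 + x%:R.
Proof. by have := hbeta j; have := ler0n R x; lra. Qed.

Lemma beta_shiftE j x : (beta j)%:C + 1 + x%:R = (beta j + 1 + x%:R)%:C.
Proof. by rewrite !rmorphD /= rmorph1 rmorph_nat. Qed.

Lemma beta_shift_neq0 j x : (beta j)%:C + 1 + x%:R != 0.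
Proof.
rewrite beta_shiftE -(rmorph0 (real_complex R)) (inj_eq (@complexI R)).
by rewrite gt_eqF ?beta_shift_gt0.
Qed.

Lemma hcoefS x :
  hcoef x.+1 = hcoef x * (\prod_(i < p) (alpha i + x%:R)) /
    (\prod_(j < q) ((beta j)%:C + 1 + x%:R)) / x.+1%:R.
Proof.
rewrite /hcoef; under eq_bigr do rewrite pochhammerS.
under [X in _ / X / _]eq_bigr do rewrite pochhammerS.
by rewrite !big_split /= factS natrM !invfM; ring.
Qed.

(** The two-term recurrence equivalent to the hypergeometric equation; the
    polynomials in [x + 1] and [x] are the two products that form [Tpoly]. *)
Lemma hcoef_step x :
  x.+1%:R * (\prod_(j < q) (x.+1%:R + (beta j)%:C)) * hcoef x.+1 =
  (\prod_(i < p) (x%:R + alpha i)) * hcoef x.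
Proof.
rewrite hcoefS.
under eq_bigr do rewrite -nat1r (addrC _ (_%:C)) addrA.
under [\prod_(i < p) (_%:R + _)]eq_bigr do rewrite addrC.
set b := \prod_(j < q) _.
have b0 : b != 0 by apply/prodf_neq0 => j _; apply: beta_shift_neq0.
have x0 : 1 + x%:R != 0 :> R[i] by rewrite nat1r pnatr_eq0.
by rewrite -nat1r; field; rewrite b0 x0.
Qed.

(** Each of the first two products tends to [1], so that the ratio behaves like
    the last factor [(x + 1) ^ (p - q - 1)]. *)
Lemma hcoef_ratio x : normc (hcoef x.+1) <= normc (hcoef x) *
  (\prod_(i < p) ((normc (alpha i) + x%:R) / x.+1%:R) *
   \prod_(j < q) (x.+1%:R / (beta j + 1 + x%:R)) *
   (x.+1%:R ^+ p / x.+1%:R ^+ q.+1)).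
Proof.
have -> : hcoef x.+1 = hcoef x * (\prod_(i < p) (alpha i + x%:R) *
    ((\prod_(j < q) ((beta j)%:C + 1 + x%:R))^-1 / x.+1%:R)).
  by rewrite hcoefS !mulrA.
rewrite normcM; apply: ler_wpM2l; first exact: normc_ge0.
rewrite 2!normcM !normcV !normc_prod normc_nat.
have -> : \prod_(j < q) normc ((beta j)%:C + 1 + x%:R) =
          \prod_(j < q) (beta j + 1 + x%:R).
  by apply: eq_bigr => j _; rewrite beta_shiftE normc_nneg ?ltW ?beta_shift_gt0.
rewrite !prodf_div !prodr_const !card_ord.
set b := \prod_(j < q) _.
have b0 : 0 < b.
  by apply: prodr_gt0 => j _; apply: beta_shift_gt0.
set y := x.+1%:R; have y0 : 0 < y by rewrite ltr0n.
rewrite [leRHS](_ : _ = (\prod_(i < p) (normc (alpha i) + x%:R)) * (b^-1 / y)).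
  apply: ler_wpM2r; first by apply: divr_ge0; rewrite ?invr_ge0 ltW.
  apply: ler_prod => i _; rewrite normc_ge0 /=.
  by apply: le_trans (le_normcD _ _) _; rewrite normc_nat.
rewrite exprS; field.
by rewrite !expf_neq0 ?gt_eqF.
Qed.

(** If [p > q + 1] the coefficients vanish from some rank on.  Otherwise the
    ratio of consecutive terms tends to [rho * 0 ^ (q + 1 - p)], that is, to
    [rho] if [p = q + 1] and to [0] if [p < q + 1]; any [rho < 1] is admissible
    in the former case and any [rho] in the latter. *)
Theorem hcoef_summable (c : R[i]) : (p = q.+1 -> `|c| < 1) ->
  ((p > q.+1)%N -> exists (i : 'I_p) (N : nat), alpha i = - N%:R) ->
  exists rho B, normc c < rho /\
    forall X, \sum_(x < X) normc (hcoef x) * rho ^+ x <= B.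
Proof.
move=> hc1 hc2; have [pq|pq] := leqP p q.+1; last first.
  have [i [N aN]] := hc2 pq.
  exists (normc c + 1), (\sum_(x < N.+1) normc (hcoef x) * (normc c + 1) ^+ x).
  split; first lra.
  have z x : (N < x)%N -> hcoef x = 0.
    move=> Nx; rewrite /hcoef (bigD1 i) //= /pochhammer.
    by rewrite (bigD1 (Ordinal Nx)) //= aN addNr !mul0r.
  move=> X; have [XN|NX] := leqP X N.+1.
    rewrite -(subnKC XN) big_split_ord /= lerDl; apply: sumr_ge0 => x _.
    by rewrite mulr_ge0 ?normc_ge0 ?exprn_ge0 // addr_ge0 ?normc_ge0.
  rewrite -(subnKC (ltnW NX)) big_split_ord /= [X in _ + X]big1 ?addr0 //.
  by move=> j _; rewrite z ?normc0 ?mul0r // ltn_addr.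
have [rho [k [cr k01 rk]]] : exists rho k : R,
    [/\ normc c < rho, 0 <= k < 1 & rho * (0 ^+ (q.+1 - p)) < k].
  have c0 := normc_ge0 c; move: pq; rewrite leq_eqVlt => /orP[/eqP pq|pq].
    have c1 : normc c < 1 by rewrite -ltcR -normcE; apply: hc1.
    (* [rho] is halfway between [|c|] and [1], and [k] between [rho] and [1]. *)
    exists ((normc c + 1) / 2), ((normc c + 3) / 4).
    by rewrite pq subnn expr0; split; [lra | apply/andP; split; lra | lra].
  exists (normc c + 1), (1 / 2).
  rewrite expr0n subn_eq0 leqNgt pq /= mulr0.
  by split; [lra | apply/andP; split; lra | lra].
have rho0 : 0 <= rho by apply: le_trans (ltW cr); apply: normc_ge0.
exists rho; suff [B HB] : exists B, forall X,
  \sum_(x < X) normc (hcoef x) * rho ^+ x <= B by exists B.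
apply: (@ratio_bounded _ (fun x => normc (hcoef x) * rho ^+ x) k) => //.
  by move=> x; rewrite mulr_ge0 ?normc_ge0 ?exprn_ge0.
pose r x := \prod_(i < p) ((normc (alpha i) + x%:R) / x.+1%:R) *
   \prod_(j < q) (x.+1%:R / (beta j + 1 + x%:R)) *
   (@harmonic R x ^+ (q.+1 - p)).
have rl : (rho * r x) @[x --> \oo] --> rho * 0 ^+ (q.+1 - p).
  apply: (cvgM_eq (erefl _)); first exact: cvg_cst.
  apply: cvgM_eq (mul1r _) _ _.
    apply: cvgM_eq (mulr1 1) _ _.
      by apply: cvg_prod_one => i; apply: cvg_shift_ratio.
    by apply: cvg_prod_one => j; apply: cvg_shift_ratio_inv.
  elim: (_ - _)%N => [|n IH]; first exact: cvg_cst.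
  under eq_fun do rewrite exprS.
  exact: cvgM_eq (esym (exprS _ _)) (@cvg_harmonic R) IH.
near=> x; have rx : rho * r x < k by near: x; exact: cvgr_lt rl _ rk.
rewrite exprS mulrA (mulrC _ rho) [leRHS]mulrA.
apply: ler_wpM2r; first exact: exprn_ge0.
apply: le_trans (_ : rho * (normc (hcoef x) * r x) <= _).
  apply: ler_wpM2l => //; apply: le_trans (hcoef_ratio x) _.
  rewrite /r /= exprVn le_eqVlt; apply/orP; left; apply/eqP; do 2!congr (_ * _).
  have y0 : x.+1%:R != 0 :> R by rewrite pnatr_eq0.
  rewrite -{1}(subnK pq) exprD; field; by rewrite !expf_neq0.
by rewrite mulrCA mulrC; apply: ler_wpM2r; [exact: normc_ge0 | exact: ltW].
Unshelve. all: by end_near.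
Qed.

End Coefficients.

(** * The generating function of the moments *)

Section Moments.
Variables (R : realType) (p q : nat) (alpha : 'I_p -> R[i]) (beta : 'I_q -> R).
Local Notation h := (hcoef alpha beta).

Lemma mu_csum n z s :
  sums_to (fun x => x%:R ^+ n * h x * z ^+ x) s -> mu alpha beta n z = s.
Proof.
move=> hs; apply: csumE; apply: eq_sums_to hs => x.
by rewrite /hcoef; ring.
Qed.

Variables (c : R[i]) (rho B : R).
Hypothesis c_rho : normc c < rho.
Hypothesis h_rho : forall X, \sum_(x < X) normc (h x) * rho ^+ x <= B.

(** The sum of the moduli along row [x] is at most
    [|h x| * |c| ^ x * e^(x |w|) <= |h x| * rho ^ x]. *)
Lemma moments_double_sum w : normc c * expR (normc w) <= rho ->
  double_sum (fun x n => h x * c ^+ x * ((x%:R * w) ^+ n / n`!%:R)).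
Proof.
move=> wrho; apply: (@double_sum_abs _ _ B) => X N.
apply: le_trans (h_rho X); apply: ler_sum => x _.
under eq_bigr do rewrite normcM.
rewrite -mulr_sumr normcM -mulrA; apply: ler_wpM2l; first exact: normc_ge0.
apply: le_trans (_ : normc (c ^+ x) * expR (normc (x%:R * w)) <= _).
  by apply: ler_wpM2l; [exact: normc_ge0 | exact: sum_normc_exp_coeff_le].
rewrite normcX normcM normc_nat expRM_natl -exprMn.
by apply: lerXn2r => //; rewrite nnegrE ?mulr_ge0 ?normc_ge0 ?expR_ge0 //
  (le_trans (normc_ge0 c)) ?ltW.
Qed.

Lemma le_mul_expR_near0 : exists2 d : R, 0 < d &
  forall w : R[i], normc w < d -> normc c * expR (normc w) <= rho.
Proof.
have rho0 : 0 <= rho := le_trans (normc_ge0 c) (ltW c_rho).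
have := normc_ge0 c; rewrite le_eqVlt => /orP[/eqP <-|c0].
  by exists 1 => // w _; rewrite mul0r.
have r1 : 1 < rho / normc c by rewrite ltr_pdivlMr // mul1r.
exists (ln (rho / normc c)) => [|w wd]; first exact: ln_gt0.
rewrite mulrC -ler_pdivlMr // -[leRHS]lnK ?ler_expR ?ltW //.
by rewrite posrE (lt_trans _ r1).
Qed.

(** The series of [mu_n] is, up to the factor [w ^ n / n!], the column [n] of
    the array of [moments_double_sum], and therefore converges as soon as one
    [w != 0] is admissible. *)
Lemma sums_to_mu n : sums_to (fun x => x%:R ^+ n * h x * c ^+ x)
  (mu alpha beta n c).
Proof.
have [d d0 dw] := le_mul_expR_near0.
pose w : R[i] := (d / 2)%:C.
have w0 : w != 0.
  by rewrite -(rmorph0 (real_complex R)) (inj_eq (@complexI R)) gt_eqF //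
    divr_gt0.
have [|_ [t [_ [_ ht _ _]]]] := @moments_double_sum w.
  by apply: dw; rewrite normc_nneg; lra.
suff H : sums_to (fun x => x%:R ^+ n * h x * c ^+ x) (n`!%:R / w ^+ n * t n).
  by rewrite (mu_csum H).
apply: eq_sums_to (sums_toZ (ht n)) => x.
rewrite exprMn; field.
by rewrite expf_neq0 //= pnatr_eq0 -lt0n fact_gt0.
Qed.

(** The rows sum to [h x * (c e^w) ^ x] and the columns to
    [mu_n(c) * w ^ n / n!]. *)
Theorem moments_generating w : normc c * expR (normc w) <= rho ->
  sums_to (fun n => mu alpha beta n c / n`!%:R * w ^+ n)
          (mu alpha beta 0 (c * expC w)).
Proof.
move=> /moments_double_sum [s [t [S [hs ht sS tS]]]].
have -> : mu alpha beta 0 (c * expC w) = S.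
  apply: mu_csum; apply: eq_sums_to sS => x.
  apply: sums_to_unique (hs x) _.
  rewrite expr0 mul1r exprMn mulrA.
  by apply: sums_toZ; apply: sums_to_expCX.
apply: eq_sums_to tS => n; apply: sums_to_unique (ht n) _.
rewrite -mulrA mulrC; apply: eq_sums_to (sums_toZ (@sums_to_mu n)) => x.
by rewrite exprMn; ring.
Qed.

End Moments.

Lemma is_expansion0_near (R : realType) (f : R[i] -> R[i]) a (d : R) : 0 < d ->
  (forall w, normc w < d -> sums_to (fun n => a n * w ^+ n) (f w)) ->
  is_expansion0 f a.
Proof.
move=> d0 H; apply/nbhs_ballP; exists d%:C => /=; first by rewrite ltcR.
move=> w; rewrite -ball_normE /= sub0r normrN normcE ltcR => wd.
exact: H.
Qed.

(** * The vectors P as operators on power series *)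

Section Truncation.
Variables (K : fieldType) (N : nat).

Lemma coef_dvdXnP (E : {poly K}) :
  reflect (forall m, (m < N)%N -> E`_m = 0) ('X^N %| E)%R.
Proof.
apply: (iffP idP) => [/dvdpP [Q ->] m mN|E0]; first by rewrite coefMXn mN.
apply/dvdpP; exists (\poly_(i < size E) E`_(i + N)).
apply/polyP => m; rewrite coefMXn; case: ltnP => [/E0 //|Nm].
rewrite coef_poly subnK //; case: ltnP => // Em.
by rewrite nth_default // (leq_trans Em) // leq_subr.
Qed.

(** The derivation [c d/dc] preserves the ideals of the [c]-adic filtration. *)
Lemma dvdXn_Xderiv (E : {poly K}) : 'X^N %| E -> 'X^N %| 'X * E^`().
Proof.
move=> /coef_dvdXnP E0; apply/coef_dvdXnP => m mN; rewrite coefXM.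
by case: m mN => //= m mN; rewrite coef_deriv E0 ?mul0rn.
Qed.

End Truncation.

Section Formal.
Variables (R : realType) (p q : nat) (alpha : 'I_p -> R[i]) (beta : 'I_q -> R).
Hypothesis hbeta : forall j, - 1 < beta j.
Local Notation h := (hcoef alpha beta).
Local Notation C := R[i].
Local Notation L := (@lead R p q).
Local Notation xi := (xi p q).

Definition trunc_mu N n : {poly C} := \poly_(x < N) (x%:R ^+ n * h x).

Lemma trunc_muS N n : trunc_mu N n.+1 = 'X * (trunc_mu N n)^`().
Proof.
apply/polyP => m; rewrite coefXM coef_poly.
case: m => [|m] /=; first by rewrite exprS mul0r mul0r if_same.
rewrite coef_deriv coef_poly; case: ifP => _; last by rewrite mul0rn.
by rewrite exprS -mulrA mulr_natl.
Qed.

Lemma coef_sum_trunc_mu (A : {poly C}) N M m : (size A <= M)%N -> (m < N)%N ->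
  (\sum_(k < M) (A`_k)%:P * trunc_mu N k)`_m = A.[m%:R] * h m.
Proof.
move=> AM mN; rewrite coef_sum (horner_coef_wide _ AM) mulr_suml.
by apply: eq_bigr => k _; rewrite coefCM coef_poly mN mulrA.
Qed.

(** The hypergeometric equation.  Replacing the power [T ^ k] by the moment of
    order [k] turns a polynomial [A(T)] into the series with coefficients
    [A(x) * h x], so that the coefficients of the sum are the differences of the
    two sides of [hcoef_step], apart from that of index [0], which vanishes
    because [T] divides the first product of [Tpoly]. *)
Lemma Tpoly_annihilates N :
  'X^N %| \sum_(k < xi.+2) (Tpoly alpha beta)`_k * trunc_mu N k.
Proof.
pose b : {poly C} := 'X * \prod_(j < q) ('X + ((beta j)%:C)%:P).
pose a : {poly C} := \prod_(i < p) ('X + (alpha i)%:P).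
have TE k : (Tpoly alpha beta)`_k = (b`_k)%:P - 'X * (a`_k)%:P.
  rewrite /Tpoly coefB coefCM -!coef_map; congr (_ `_ k - 'X * _ `_ k).
    rewrite /b rmorphM rmorph_prod /= map_polyX.
    by under [in RHS]eq_bigr do rewrite rmorphD /= map_polyX map_polyC.
  rewrite /a rmorph_prod.
  by under [in RHS]eq_bigr do rewrite rmorphD /= map_polyX map_polyC.
(* Any common bound for the three sizes will do; the coefficients of [Tpoly]
   beyond [xi.+1] vanish. *)
pose M := (xi.+2 + (size b + size a))%N.
have -> : \sum_(k < xi.+2) (Tpoly alpha beta)`_k * trunc_mu N k =
          \sum_(k < M) (Tpoly alpha beta)`_k * trunc_mu N k.
  rewrite [RHS]big_split_ord /= [X in _ + X]big1 ?addr0 // => k _.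
  by rewrite nth_default ?mul0r // (leq_trans (Tpoly_size _ _)) ?leq_addr.
have bM : (size b <= M)%N by rewrite /M; lia.
have aM : (size a <= M)%N by rewrite /M; lia.
under eq_bigr do rewrite TE mulrBl -mulrA.
rewrite sumrB -mulr_sumr; apply/coef_dvdXnP => m mN.
rewrite coefB (coef_sum_trunc_mu bM mN) coefXM.
case: m mN => [|m] mN /=.
  by rewrite subr0 /b hornerM hornerX mul0r mul0r.
rewrite (coef_sum_trunc_mu aM (ltnW mN)) /b /a hornerM hornerX !horner_prod.
under eq_bigr do rewrite hornerD hornerX hornerC.
under [X in _ - X * _]eq_bigr do rewrite hornerD hornerX hornerC.
by rewrite (hcoef_step alpha hbeta) subrr.
Qed.

Lemma sigma_recurrence N :
  'X^N %| \sum_(j < xi.+1) sigma alpha beta j * trunc_mu N j -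
    L * trunc_mu N xi.+1.
Proof.
have := Tpoly_annihilates N; rewrite big_ord_recr /= Tpoly_lead => H.
suff -> : \sum_(j < xi.+1) sigma alpha beta j * trunc_mu N j -
    L * trunc_mu N xi.+1 =
  - (eps p q)%:~R * (\sum_(i < xi.+1) (Tpoly alpha beta)`_i * trunc_mu N i +
     (eps p q)%:~R * L * trunc_mu N xi.+1) by exact: dvdp_mull.
rewrite mulrDr mulNr !mulrA mulNr epsK mulN1r mulNr; congr (_ - _).
rewrite -mulNr mulr_sumr; apply: eq_bigr => j _.
by rewrite /sigma !mulNr mulrA.
Qed.

Lemma deriv_lead : L^`() = (tau p q)%:~R.
Proof.
by rewrite /lead -!(rmorph_int polyC) derivD derivM derivX !derivC mul1r mulr0
  addr0 add0r.
Qed.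

(** [M mu = L theta mu], the last row being the hypergeometric equation. *)
Lemma Mmx_trunc_mu N (j : 'I_xi.+1) : \sum_i Mmx alpha beta j i * trunc_mu N i =
  L * trunc_mu N j.+1 + (j == ord_max)%:R *
    (\sum_(i < xi.+1) sigma alpha beta i * trunc_mu N i - L * trunc_mu N xi.+1).
Proof.
have [->|jx] := eqVneq j ord_max.
  rewrite mul1r addrC subrK; apply: eq_bigr => i _.
  by rewrite mxE eqxx.
have jx' : (j < xi)%N.
  rewrite ltn_neqAle -ltnS ltn_ord andbT; apply: contra jx => /eqP ?.
  exact/eqP/val_inj.
rewrite mul0r addr0 (bigD1 (Ordinal (jx' : (j.+1 < xi.+1)%N))) //= mxE /=.
rewrite eqxx ltn_eqF // big1 ?addr0 // => i ij; rewrite mxE ltn_eqF //.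
case: eqP => [E|_]; last by rewrite mul0r.
by move: ij; rewrite -val_eqE /= E eqxx.
Qed.

Lemma PvecS n i : Pvec alpha beta n.+1 i ord0 =
  'X * L * (Pvec alpha beta n i ord0)^`()
  + \sum_j Mmx alpha beta j i * Pvec alpha beta n j ord0
  - n%:R * (tau p q)%:~R * 'X * Pvec alpha beta n i ord0.
Proof.
rewrite /= mulmxBl mul_scalar_mx !mxE -addrA; congr (_ + (_ - _)).
by apply: eq_bigr => j _; rewrite !mxE.
Qed.

(** If [E] denotes the difference for [n] and [H] the one in
    [sigma_recurrence], then the difference for [n + 1] is
    [L * theta E - n * tau * c * E + P_n,xi * H], where [theta = c d/dc]; the
    term [n * tau * c] in the definition of [P_(n+1)] compensates the derivative
    of [L ^ n]. *)
Theorem Pvec_moments N n : 'X^N %|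
  \sum_(i < xi.+1) Pvec alpha beta n i ord0 * trunc_mu N i
    - L ^+ n * trunc_mu N n.
Proof.
elim: n => [|n IH].
  rewrite big_ord_recl big1 ?addr0; last first.
    by move=> i _; rewrite mxE mul0r.
  by rewrite mxE eqxx expr0 !mul1r subrr dvdp0.
set P := fun i => Pvec alpha beta n i ord0.
set E := _ - _ in IH.
set H := \sum_(j < xi.+1) sigma alpha beta j * trunc_mu N j -
    L * trunc_mu N xi.+1.
suff -> : \sum_(i < xi.+1) Pvec alpha beta n.+1 i ord0 * trunc_mu N i
    - L ^+ n.+1 * trunc_mu N n.+1 =
  L * ('X * E^`()) - n%:R * (tau p q)%:~R * 'X * E + P ord_max * H.
  apply: dvdp_add; last exact/dvdp_mull/sigma_recurrence.
  by apply: dvdp_sub; apply: dvdp_mull => //; apply: dvdXn_Xderiv.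
set S0 := \sum_(i < xi.+1) P i * trunc_mu N i.
pose S1 := \sum_(i < xi.+1) (P i)^`() * trunc_mu N i.
pose S2 := \sum_(i < xi.+1) P i * trunc_mu N i.+1.
have DS : 'X * S0^`() = 'X * S1 + S2.
  rewrite (raddf_sum (@deriv _)) !mulr_sumr -big_split.
  by apply: eq_bigr => i _ /=; rewrite derivM trunc_muS; ring.
have DE : 'X * E^`() = 'X * S1 + S2 - L ^+ n * trunc_mu N n.+1
    - n%:R * L ^+ n.-1 * (tau p q)%:~R * 'X * trunc_mu N n.
  rewrite /E derivB mulrBr DS derivM deriv_exp deriv_lead trunc_muS.
  by rewrite -mulr_natl; ring.
have -> : \sum_(i < xi.+1) Pvec alpha beta n.+1 i ord0 * trunc_mu N i =
    'X * L * S1 + (L * S2 + P ord_max * H) - n%:R * (tau p q)%:~R * 'X * S0.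
  under eq_bigr do rewrite PvecS mulrBl mulrDl mulr_suml.
  rewrite sumrB big_split /= exchange_big /=; congr (_ + _ - _).
  - by rewrite mulr_sumr; apply: eq_bigr => i _; rewrite mulrA.
  - transitivity (\sum_j P j * \sum_i Mmx alpha beta j i * trunc_mu N i).
      apply: eq_bigr => j _; rewrite mulr_sumr.
      by apply: eq_bigr => i _; rewrite /P; ring.
    under eq_bigr do rewrite Mmx_trunc_mu -/H mulrDr.
    rewrite big_split /=; congr (_ + _).
      by rewrite mulr_sumr; apply: eq_bigr => j _; rewrite mulrCA.
    rewrite (bigD1 ord_max) //= eqxx mul1r big1 ?addr0 // => j /negPf ->.
    by rewrite mul0r mulr0.
  by rewrite mulr_sumr; apply: eq_bigr => i _; rewrite mulrA.
rewrite DE /E -/S0 exprS; case: (n) => [|m] /=; first ring.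
by rewrite [L ^+ m.+1]exprS; ring.
Qed.

End Formal.

(** * Evaluation of power series identities *)

Section Evaluation.
Variable R : realType.
Implicit Types (P : {poly R[i]}) (u : nat -> R[i]).

Lemma coef_mul_trunc P u c N m : (m < N)%N ->
  (P * \poly_(x < N) u x)`_m * c ^+ m =
  \sum_(j < size P) P`_j * c ^+ j * iter j (@delay _) (fun x => u x * c ^+ x) m.
Proof.
move=> mN; rewrite -{1}[P]coefK poly_def mulr_suml coef_sum mulr_suml.
apply: eq_bigr => j _; rewrite -scalerAl coefZ coefXnM iter_delayE ltnNge.
case: leqP => jm /=; last by rewrite !(mulr0, mul0r).
rewrite coef_poly (leq_ltn_trans (leq_subr _ _) mN) -{2}(subnK jm) exprD.
ring.
Qed.

(** The Cauchy product with a polynomial is a finite combination of delayed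
    series. *)
Lemma sums_to_mul_trunc P u c s : sums_to (fun x => u x * c ^+ x) s ->
  sums_to (fun m => (P * \poly_(x < m.+1) u x)`_m * c ^+ m) (P.[c] * s).
Proof.
move=> us; rewrite horner_coef mulr_suml.
have H (j : 'I_(size P)) : sums_to (fun m => P`_j * c ^+ j *
    iter j (@delay _) (fun x => u x * c ^+ x) m) (P`_j * c ^+ j * s).
  exact/sums_toZ/sums_to_iter_delay.
apply: eq_sums_to (sums_to_sum (r := index_enum _) H) => m.
by rewrite (@coef_mul_trunc _ _ _ m.+1).
Qed.

End Evaluation.

Section PvecEvaluation.
Variables (R : realType) (p q : nat) (alpha : 'I_p -> R[i]) (beta : 'I_q -> R).
Hypothesis hbeta : forall j, - 1 < beta j.
Variable c : R[i].
Hypothesis mu_sums : forall n,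
  sums_to (fun x => x%:R ^+ n * hcoef alpha beta x * c ^+ x)
          (mu alpha beta n c).

Theorem Pvec_dot_muvec n :
  \sum_i (Pvec alpha beta n i ord0).[c] * mu alpha beta i c =
  (lead p q).[c] ^+ n * mu alpha beta n c.
Proof.
have left := sums_to_sum (r := index_enum 'I_(xi p q).+1) (fun i =>
  sums_to_mul_trunc (P := Pvec alpha beta n i ord0) (mu_sums (n := i))).
have right := sums_to_mul_trunc (P := lead p q ^+ n) (mu_sums (n := n)).
rewrite hornerE in right; apply: sums_to_unique left _.
apply: eq_sums_to right => m; rewrite -mulr_suml -coef_sum; congr (_ * _).
have /coef_dvdXnP/(_ m (leqnn _)) := Pvec_moments alpha hbeta m.+1 n.
by rewrite coefB => /eqP; rewrite subr_eq0 => /eqP ->.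
Qed.

End PvecEvaluation.

(** * The two expansions *)

Theorem mainTheorem2 (R : realType) (p q : nat)
  (alpha : 'I_p -> R[i]) (beta : 'I_q -> R) (c : R[i])
  (hbeta : forall j, - 1 < beta j)
  (hc1 : p = q.+1 -> `|c| < 1)
  (hc2 : (p > q.+1)%N ->
     (exists (i : 'I_p) (N : nat), (0 < N)%N /\ alpha i = - N%:R) /\ c != 0) :
  is_expansion0 (fun w => mu alpha beta 0 (c * expC w)) (Gmu alpha beta c)
  /\
  is_expansion0
    (fun w => mu alpha beta 0
       (c * expC (((lambda p q)%:~R + (tau p q)%:~R * c) * w)))
    (fun n => dotv (GP alpha beta c n) (muvec alpha beta c)).
Proof.
have [|rho [B [c_rho h_rho]]] := hcoef_summable (alpha := alpha) hbeta hc1.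
  by move=> /hc2 [[i [N [_ aN]]] _]; exists i, N.
have [d d0 dw] := le_mul_expR_near0 c_rho.
have gen w : normc w < d -> sums_to (fun n => Gmu alpha beta c n * w ^+ n)
    (mu alpha beta 0 (c * expC w)).
  by move=> wd; apply: (moments_generating c_rho h_rho); apply: dw.
(* The second expansion is the first one at [l * w]. *)
split; first exact: is_expansion0_near d0 gen.
set l := (lambda p q)%:~R + _ * c.
have lE : (lead p q).[c] = l.
  rewrite /lead -!(rmorph_int polyC) hornerD hornerM hornerX !hornerC.
  by rewrite /l mulrC.
have l0 : 0 < normc l + 1 by rewrite ltr_wpDl ?normc_ge0.
apply: (@is_expansion0_near _ _ _ (d / (normc l + 1))).
  by rewrite divr_gt0.
move=> w wd; apply: eq_sums_to (gen (l * w) _) => [n|]; last first.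
  rewrite normcM; apply: le_lt_trans (_ : (normc l + 1) * normc w < d).
    by apply: ler_wpM2r; [exact: normc_ge0 | rewrite lerDl].
  by rewrite mulrC -ltr_pdivlMr.
rewrite /dotv /GP /muvec /Gmu; under [in RHS]eq_bigr do rewrite !mxE mulrAC.
have sm k : sums_to (fun x => x%:R ^+ k * hcoef alpha beta x * c ^+ x)
    (mu alpha beta k c) by apply: (sums_to_mu c_rho h_rho).
rewrite -mulr_suml (Pvec_dot_muvec hbeta sm) lE exprMn; ring.
Qed.
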